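(* Let $(\mathscr{G},d_{\mathscr{G}})$ be a separable metric semigroup, let $z_0,z_1\in\mathscr{G}$, $a,b\in[0,\infty)$, and let $X_1,\dots,X_n\in L^0(\Omega,\mathscr{G})$ be independent. Put $S_k:=X_1X_2\cdots X_k$ for $1\leqslant k\leqslant n$. Then for all integers $1\leqslant m\leqslant n$, \[ \mathbb{P}_\mu\left(\min_{m\leqslant k\leqslant n}d_{\mathscr{G}}(z_1,z_0S_k)\leqslant a\right)\cdot\min_{m\leqslant k\leqslant n}\mathbb{P}_\mu\left(d_{\mathscr{G}}(S_k,S_n)\leqslant b\right)\leqslant\mathbb{P}_\mu\left(d_{\mathscr{G}}(z_1,z_0S_n)\leqslant a+b\right), \] \[ \mathbb{P}_\mu\left(\max_{m\leqslant k\leqslant n}d_{\mathscr{G}}(z_1,z_0S_k)\geqslant a\right)\cdot\min_{m\leqslant k\leqslant n}\mathbb{P}_\mu\left(d_{\mathscr{G}}(S_k,S_n)\leqslant b\right)\leqslant\mathbb{P}_\mu\left(d_{\mathscr{G}}(z_1,z_0S_n)\geqslant a-b\right). \]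
   Context: A metric semigroup is a semigroup $(\mathscr{G},\cdot)$ (a set with an associative binary operation) equipped with a metric $d_{\mathscr{G}}:\mathscr{G}\times\mathscr{G}\to[0,\infty)$ that is translation-invariant: $d_{\mathscr{G}}(ac,bc)=d_{\mathscr{G}}(a,b)=d_{\mathscr{G}}(ca,cb)$ for all $a,b,c\in\mathscr{G}$. It need not be commutative nor have an identity. It is separable if the metric space is separable. $(\Omega,\mathscr{A},\mu)$ is a probability space, $\mathbb{P}_\mu$ denotes probability with respect to $\mu$, and $L^0(\Omega,\mathscr{G})$ is the set of $\mathscr{G}$-valued (Borel measurable) random variables. *)

(* Defs.v *)
From HB Require Import structures.
From mathcomp Require Import all_boot all_order all_algebra finmap.
From mathcomp Require Import all_classical all_reals all_analysis.

Set Implicit Arguments.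
Unset Strict Implicit.
Unset Printing Implicit Defensive.

Import Order.TTheory GRing.Theory Num.Theory.

Local Open Scope classical_set_scope.
Local Open Scope ring_scope.

HB.mixin Record isTranslationInvariant (R : realType) G
    & Semigroup G & Metric R G := {
  mdist_mulr : forall a b c : G, mdist (a * c)%g (b * c)%g = mdist a b ;
  mdist_mull : forall a b c : G, mdist (c * a)%g (c * b)%g = mdist a b
}.

(* The base point, with no relation to the operation, is what `measurableType`
   asks of the Borel space of G; any nonempty metric semigroup can be given
   one. *)
#[short(type="metricSemigroupType")]
HB.structure Definition MetricSemigroup (R : realType) :=
  { G of Semigroup G & Metric R G & Pointed G
       & isTranslationInvariant R G }.

Definition separable (T : topologicalType) : Prop :=
  exists2 D : set T, countable D & dense D.

Notation borel G := (g_sigma_algebraType (@open G)).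

Definition mutually_independent d d' (T : measurableType d)
    (T' : measurableType d') (R : realType) (P : probability T R)
    (I : choiceType) (D : set I) (X : I -> {RV P >-> T'}) : Prop :=
  forall (J : {fset I}) (A : I -> set T'),
    [set` J] `<=` D -> (forall i, i \in J -> measurable (A i)) ->
    P (\bigcap_(i in [set` J]) X i @^-1` A i)
      = (\prod_(i <- J) P (X i @^-1` A i))%E.

Arguments mutually_independent {d d' T T' R} P {I} D X.

(* x 1 * x 2 * ... * x k for k >= 1; a semigroup has no empty product, so the
   value x 1 at k = 0 is a dummy. *)
Definition partial_prod (G : semigroupType) (x : nat -> G) (k : nat) : G :=
  foldl (fun g i => (g * x i)%g) (x 1%N) (iota 2 k.-1).

Lemma partial_prod1 (G : semigroupType) (x : nat -> G) :
  partial_prod x 1 = x 1%N.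
Proof. by []. Qed.

Lemma partial_prodS (G : semigroupType) (x : nat -> G) (k : nat) :
  (0 < k)%N -> partial_prod x k.+1 = (partial_prod x k * x k.+1)%g.
Proof.
by case: k => // k _; rewrite /partial_prod -[k.+2.-1]addn1 iotaD foldl_cat.
Qed.

(* Main.v *)
Require Import Defs.
From mathcomp Require Import all_boot all_order all_algebra finmap.
From mathcomp Require Import all_classical all_reals all_analysis.
From mathcomp Require Import lra zify.

(** The inequality is of Ottaviani type.  Split the event that some [S_k],
    [m <= k <= n], lies in a target set [A] according to the first such [k].
    The event [E_k] that the first visit happens at time [k] depends only on
    [X_1, ..., X_k].  If moreover [S_n] is within [b] of [S_k], then [S_n] lies
    in any set [A'] containing the [b]-neighbourhood of [A].  Once [E_k] is
    independent of [d(S_k, S_n) <= b], summing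
    [P(E_k) * P(d(S_k, S_n) <= b) <= P(E_k /\ S_n \in A')] over [k] gives the
    result ([ottaviani]).  The two inequalities of the theorem are the cases of
    closed balls around [z1] and of complements of open balls, seen through
    [g |-> z0 * g].

    The independence is where the semigroup structure enters.  Write
    [S_n = S_k * Y] with [Y = X_(k+1) ... X_n].  There is no identity to cancel
    [S_k] against, but translation invariance gives
    [d(x, x * y) = d(x * y, x * y * y) = d(y, y * y)] ([mdist_mul_self]), so
    [d(S_k, S_n) = d(Y, Y * Y)] depends only on [X_(k+1), ..., X_n].  Disjoint
    blocks of independent variables generate independent sigma-algebras, by
    Dynkin's lemma applied to one block and then to the other
    ([independent_blocks]).

    Separability is used for measurability: it makes the product of two
    measurable maps measurable ([measurable_fun_mulg]), hence also the partial
    products, with respect to the sigma-algebra of whichever block they are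
    built from. *)

Set Implicit Arguments.
Unset Strict Implicit.
Unset Printing Implicit Defensive.

Import Order.TTheory GRing.Theory Num.Theory.

Local Open Scope classical_set_scope.
Local Open Scope ring_scope.

(** * Lipschitz functions on a metric space *)

Section metric_space.
Context (R : realType) (M : metricType R).

Lemma open_lipschitz_lt (h : M -> R) (c r : R) : 0 < c ->
  (forall x y, h y <= h x + c * mdist x y) -> open [set x | h x < r].
Proof.
move=> c0 hlip; rewrite openE => x /= hxr; apply/nbhs_ballP.
exists ((r - h x) / c) => /=; first by rewrite divr_gt0// subr_gt0.
rewrite ballEmdist => y /=; rewrite ltr_pdivlMr// => xy.
by have := hlip x y; lra.
Qed.

Lemma open_mball (x : M) (r : R) : open [set y | mdist x y < r].
Proof.
apply: (@open_lipschitz_lt _ 1) => // y z.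
by rewrite mul1r; exact: metric_triangle.
Qed.

Lemma closed_lipschitz_le (h : M -> R) (c r : R) : 0 < c ->
  (forall x y, h y <= h x + c * mdist x y) -> closed [set x | h x <= r].
Proof.
move=> c0 hlip; rewrite -openC (_ : ~` _ = [set x | - h x < - r]).
  apply: (open_lipschitz_lt _ c0) => x y.
  by have := hlip y x; rewrite metric_sym; lra.
by apply/seteqP; split => x /=; rewrite ltrN2 ltNge; [move/negP|move=> /negP].
Qed.

End metric_space.

(** * Measurability of products in a separable metric semigroup *)

Lemma countable_bigcup_measurable d (T : sigmaRingType d) U (I : set U)
    (F : U -> set T) : countable I ->
  (forall i, I i -> measurable (F i)) -> measurable (\bigcup_(i in I) F i).
Proof.
move=> /pfcard_geP[->|[e]] mF; first by rewrite bigcup_set0.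
rewrite (_ : bigcup _ _ = \bigcup_n F (e n)).
  by apply: bigcupT_measurable => n; apply: mF; exact: funS.
apply/seteqP; split => [t [i Ii Fit]|t [n _ Ft]].
  by have [n _ ni] := @surj _ _ _ _ e i Ii; exists n => //; rewrite ni.
by exists (e n) => //; exact: funS.
Qed.

Section metric_semigroup.
Context (R : realType) (G : metricSemigroupType R).
Implicit Types x y z : G.

Lemma mdist_mul x x' y y' :
  mdist (x * y)%g (x' * y')%g <= mdist x x' + mdist y y'.
Proof.
apply: (le_trans (metric_triangle _ (x' * y)%g _)).
by rewrite mdist_mulr mdist_mull.
Qed.

(** Multiply on the right by [y], then cancel [x] on the left.  The right-hand
    side plays the role of the distance from the identity to [y], which need not
    exist: it does not depend on [x]. *)
Lemma mdist_mul_self x y : mdist x (x * y)%g = mdist y (y * y)%g.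
Proof. by rewrite -(mdist_mulr x _ y) -mulgA mdist_mull. Qed.

Lemma partial_prodD (x : nat -> G) k l : (0 < k)%N -> (0 < l)%N ->
  partial_prod x (k + l) =
  (partial_prod x k * partial_prod (fun i => x (k + i)%N) l)%g.
Proof.
move=> k0; case: l => // l _; elim: l => [|l IH].
  by rewrite addn1 partial_prodS// partial_prod1 addn1.
rewrite addnS partial_prodS ?addn_gt0 ?k0// IH.
by rewrite [in RHS]partial_prodS// mulgA !addnS.
Qed.

Lemma measurable_borel_closed (C : set G) :
  closed C -> measurable (C : set (borel G)).
Proof.
move=> cC; rewrite -[X in measurable X]setCK; apply: measurableC.
by apply: sub_sigma_algebra; rewrite /= openC.
Qed.

Section measurability_of_products.
Hypothesis sepG : separable G.
Context d (T : measurableType d).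

(** Multiplication is continuous, and an open subset of [G * G] is a countable
    union of products of balls centred in a countable dense set. *)
Lemma measurable_fun_mulg (f g : T -> borel G) :
  measurable_fun setT f -> measurable_fun setT g ->
  measurable_fun setT (fun t => ((f t : G) * (g t : G))%g : borel G).
Proof.
move=> mf mg; case: sepG => D cD dD.
have borelE : @measurable _ (borel G) = <<s @open G >> by [].
apply: (measurability _ borelE) => // _ [U oU <-]; rewrite setTI.
pose r (n : nat) : R := n.+1%:R^-1.
pose near p n : set G := [set x | mdist p x < r n].
pose I := [set i : G * G * nat | (D `*` D `*` setT) i /\
  forall x y, near i.1.1 i.2 x -> near i.1.2 i.2 y -> U (x * y)%g].
have cI : countable I.
  apply: (@sub_countable _ _ _ (D `*` D `*` [set: nat])).
    by apply: subset_card_le => i [].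
  by do 2?apply: countableX.
pose F i := f @^-1` near i.1.1 i.2 `&` g @^-1` near i.1.2 i.2.
have mF i : measurable (F i).
  by apply: measurableI; rewrite -[X in measurable X]setTI;
    [apply: mf|apply: mg] => //; apply: sub_sigma_algebra; exact: open_mball.
rewrite [X in measurable X](_ : _ = \bigcup_(i in I) F i); last first.
  apply/seteqP; split => [t Ut|t [i [_ iU] [fi gi]]]; last first.
    exact: iU fi gi.
  have /nbhs_ballP[e /= e0 eU] : nbhs ((f t : G) * (g t : G))%g U.
    exact: open_nbhs_nbhs.
  (* Through [p], [f t] is within [2 * r n] of [x], and through [q], [g t] is
     within [2 * r n] of [y]; so [x * y] is within [4 * r n] of [f t * g t]. *)
  have [n nE] : exists n, r n < e / 4.
    exists (Num.truncn (e / 4)^-1).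
    by rewrite /r invf_plt ?posrE ?divr_gt0// truncnS_gt.
  have r0 : 0 < r n by rewrite /r invr_gt0.
  have approx x : exists2 p, D p & mdist p x < r n.
    have [|p [xp Dp]] := dD _ _ (open_mball x (r n)).
      by exists x => /=; rewrite mdistxx.
    by exists p => //; rewrite metric_sym.
  have [p Dp pf] := approx (f t).
  have [q Dq qg] := approx (g t).
  exists (p, q, n) => //; split => //= x y px qy.
  apply: eU; rewrite ballEmdist /=.
  have := mdist_mul (f t) x (g t) y.
  have := metric_triangle (f t) p x; have := metric_triangle (g t) q y.
  rewrite [mdist (f t) p]metric_sym [mdist (g t) q]metric_sym.
  by move: px qy; rewrite /near/=; lra.
exact: countable_bigcup_measurable.
Qed.

(** The measurable space [T] is arbitrary so that it can be taken to carry only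
    the sigma-algebra of a block of variables. *)
Lemma measurable_fun_partial_prod (X : nat -> T -> borel G) k : (0 < k)%N ->
  (forall i, (1 <= i <= k)%N -> measurable_fun setT (X i)) ->
  measurable_fun setT (fun t => partial_prod (fun i => X i t : G) k : borel G).
Proof.
case: k => // k _; elim: k => [mX|k IH mX]; first exact: (mX 1%N).
under eq_fun do rewrite partial_prodS//.
apply: measurable_fun_mulg; last by apply: mX; rewrite leqnn.
by apply: IH => i /andP[i1 ik]; apply: mX; rewrite i1 ltnW.
Qed.

End measurability_of_products.
End metric_semigroup.

(** * Independence of disjoint blocks of variables *)

Section independent_blocks.
Context d (T : measurableType d) (R : realType) (P : probability T R).

(** Both sides are finite measures in [E], so they agree on the sigma-algebra
    as soon as they agree on the generating pi-system [C]. *)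
Lemma independent_g_sigma_algebra (C : set (set T)) (F : set T) :
  C `<=` measurable -> setI_closed C -> C setT -> measurable F ->
  (forall E, C E -> P (E `&` F) = P E * P F)%E ->
  forall E, <<s C >> E -> P (E `&` F) = (P E * P F)%E.
Proof.
move=> Cm CI CT mF CF E sCE.
have PF0 : 0 <= fine (P F) by exact: fine_ge0.
have [r PFE] : exists r : {nonneg R}, P F = r%:num%:E.
  by exists (NngNum PF0); rewrite /= fineK// fin_num_measure.
rewrite muleC PFE.
apply: (g_sigma_algebra_measure_unique C Cm (fun=> setT) (fun=> CT) _
  (mrestr P mF) (mscale r P)) => //.
- by rewrite bigcup_const//; exists 0%N.
- by move=> A CA; rewrite /= /mscale -PFE muleC; exact: CF.
- by move=> k; rewrite -ge0_fin_numE// fin_num_measure.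
Qed.

Context d' (T' : measurableType d') (I : choiceType).
Variables (D : set I) (X : I -> {RV P >-> T'}).
Implicit Types J : {fset I}.

(** All indices of [J] are constrained, possibly by the full space: for a fixed
    [J] this makes the cylinders a pi-system at once. *)
Definition cylinders J : set (set T) :=
  [set E | exists2 A : I -> set T', (forall i, measurable (A i)) &
    E = \bigcap_(i in [set` J]) X i @^-1` A i].

Lemma cylindersI J : setI_closed (cylinders J).
Proof.
move=> _ _ [A mA ->] [B mB ->]; exists (fun i => A i `&` B i).
  by move=> i; exact: measurableI.
by rewrite -bigcapI.
Qed.

Lemma cylindersT J : cylinders J setT.
Proof.
by exists (fun=> setT) => //; apply/esym; rewrite -subTset => t _ i.
Qed.

Lemma measurable_cylinders J : cylinders J `<=` measurable.
Proof.
move=> _ [A mA ->]; apply: fin_bigcap_measurable => // i _.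
by rewrite -[X in measurable X]setTI; exact: measurable_funP.
Qed.

Lemma g_cylinders_measurable J : <<s cylinders J >> `<=` measurable.
Proof.
apply: smallest_sub; first exact: sigma_algebra_measurable.
exact: measurable_cylinders.
Qed.

Lemma measurable_fun_cylinders J i : i \in J ->
  measurable_fun setT (X i : g_sigma_algebraType (cylinders J) -> T').
Proof.
move=> iJ _ B mB; rewrite setTI; apply: sub_sigma_algebra.
exists (fun j => if j == i then B else setT) => [j|]; first by case: ifP.
apply/seteqP; split => [t Bt j _ /=|t /(_ i iJ)/=]; last by rewrite eqxx.
by case: eqP => // ->.
Qed.

Hypothesis indepX : mutually_independent P D X.

(** Disjointness of [J] and [K] lets the two families of constraints be merged
    into one family indexed by their union, to which mutual independence
    applies. *)
Lemma independent_cylinders J K E F : [disjoint J & K]%fset ->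
  [set` J] `<=` D -> [set` K] `<=` D ->
  cylinders J E -> cylinders K F -> P (E `&` F) = (P E * P F)%E.
Proof.
move=> /fdisjointP JK JD KD [A mA ->] [B mB ->].
pose AB i := if i \in J then A i else B i.
have mAB i : measurable (AB i) by rewrite /AB; case: ifP.
have ABJ i : i \in J -> AB i = A i by rewrite /AB => ->.
have ABK i : i \in K -> AB i = B i.
  by rewrite /AB; case: ifP => // /JK/negbTE ->.
rewrite -(eq_bigcapr (fun i iJ => congr1 (fun B => X i @^-1` B) (ABJ i iJ))).
rewrite -(eq_bigcapr (fun i iK => congr1 (fun B => X i @^-1` B) (ABK i iK))).
have -> : \bigcap_(i in [set` J]) X i @^-1` AB i `&`
          \bigcap_(i in [set` K]) X i @^-1` AB i =
          \bigcap_(i in [set` (J `|` K)%fset]) X i @^-1` AB i.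
  by rewrite set_fsetU bigcap_setU.
rewrite !indepX//; last by rewrite set_fsetU subUset.
rewrite (big_fsetID _ (mem J))/=; congr (_ * _)%E;
  by apply: eq_fbigl => i; rewrite !inE; case: (boolP (i \in J)) => //= iJ;
     rewrite ?andbT ?andbF// (negbTE (JK i iJ)).
Qed.

Lemma independent_blocks J K E F : [disjoint J & K]%fset ->
  [set` J] `<=` D -> [set` K] `<=` D ->
  <<s cylinders J >> E -> <<s cylinders K >> F -> P (E `&` F) = (P E * P F)%E.
Proof.
move=> JK JD KD sE sF; move: E sE.
apply: independent_g_sigma_algebra.
- exact: measurable_cylinders.
- exact: cylindersI.
- exact: cylindersT.
- exact: g_cylinders_measurable sF.
(* Second application of the pi-system argument, now in [F] with the cylinder
   [E] fixed. *)
move=> E cE; rewrite setIC muleC; move: F sF.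
apply: independent_g_sigma_algebra.
- exact: measurable_cylinders.
- exact: cylindersI.
- exact: cylindersT.
- exact: measurable_cylinders cE.
by move=> F cF; rewrite setIC muleC; exact: (independent_cylinders JK).
Qed.

End independent_blocks.

(** * First-passage decomposition *)

(** [seqDU C i] is the event that [i] is the first index at which [C] occurs.
    These events are disjoint and cover the union of the [C i], so the
    hypothesis can be summed over [i]. *)
Lemma first_entrance_le d (T : measurableType d) (R : realType)
    (P : probability T R) (C : nat -> set T) (E : set T) (beta : \bar R) N :
  (forall i, measurable (C i)) -> measurable E ->
  (forall i, (i < N)%N -> P (seqDU C i) * beta <= P (seqDU C i `&` E))%E ->
  (P (\big[setU/set0]_(i < N) C i) * beta <= P E)%E.
Proof.
move=> mC mE CE; have mD := seqDU_measurable mC.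
have tD := @trivIset_seqDU _ C.
rewrite bigsetU_seqDU measure_semi_additive_ord_I//; last 2 first.
- exact: sub_trivIset tD.
- exact: bigsetU_measurable.
rewrite ge0_sume_distrl//.
apply: (@le_trans _ _ (\sum_(i < N) P (seqDU C i `&` E))%E).
  by apply: lee_sum => i _; exact: CE.
rewrite -(measure_semi_additive_ord_I P (F := fun i => seqDU C i `&` E)).
- apply: le_measure; rewrite ?inE//.
    by apply: bigsetU_measurable => i _; exact: measurableI.
  by rewrite -big_distrl/=; exact: subIsetr.
- by move=> i ?; exact: measurableI.
- by apply: trivIset_setIr; exact: sub_trivIset tD.
- by apply: bigsetU_measurable => i _; exact: measurableI.
Qed.

Section ottaviani.
Context (R : realType) (G : metricSemigroupType R) (sepG : separable G).
Context d (T : measurableType d) (mu : probability T R).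
Variables (n : nat) (X : nat -> {RV mu >-> borel G}).
Hypothesis indepX : mutually_independent mu [set i | (1 <= i <= n)%N] X.

Let S k t : G := partial_prod (fun i => X i t : G) k.

Let prefix k : {fset nat} := [fset i in iota 1 k]%fset.
Let suffix k : {fset nat} := [fset i in iota k.+1 (n - k)]%fset.

Let measurable_prefix k l (Q : set (borel G)) : (0 < k <= l)%N ->
  measurable Q -> <<s cylinders X (prefix l) >> (S k @^-1` Q).
Proof.
move=> /andP[k0 kl] mQ.
suff mS : measurable_fun setT
    (S k : g_sigma_algebraType (cylinders X (prefix l)) -> borel G).
  by rewrite -[X in <<s _>> X]setTI; exact: mS.
apply: measurable_fun_partial_prod => // i ik.
by apply: measurable_fun_cylinders; rewrite !inE mem_iota; lia.
Qed.

Let measurable_S k : (0 < k)%N -> measurable_fun setT (S k : T -> borel G).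
Proof. by move=> k0; apply: measurable_fun_partial_prod. Qed.

(** Although [S_k] and [S_n] both involve the first [k] variables, their distance
    is [d(Y, Y * Y)] with [Y = X_(k+1) ... X_n], and [y |-> d(y, y * y)] is
    3-Lipschitz, hence measurable. *)
Let measurable_suffix k b : (0 < k < n)%N ->
  <<s cylinders X (suffix k) >> [set t | mdist (S k t) (S n t) <= b].
Proof.
move=> /andP[k0 kn].
pose Y t : G := partial_prod (fun i => X (k + i)%N t : G) (n - k).
rewrite (_ : mkset _ = Y @^-1` [set y | mdist y (y * y)%g <= b]); last first.
  have SE t : S n t = (S k t * Y t)%g.
    by rewrite /S -[in LHS](subnKC (ltnW kn)) partial_prodD ?subn_gt0.
  by apply/seteqP; split => t /=; rewrite SE mdist_mul_self.
suff mY : measurable_fun setT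
    (Y : g_sigma_algebraType (cylinders X (suffix k)) -> borel G).
  rewrite -[X in <<s _>> X]setTI; apply: mY => //.
  apply: measurable_borel_closed; apply: (@closed_lipschitz_le _ _ _ 3) => //.
  move=> y z; have := metric_triangle z y (z * z)%g.
  have := metric_triangle y (y * y)%g (z * z)%g.
  by have := mdist_mul y z y z; rewrite [mdist z y]metric_sym; lra.
apply: measurable_fun_partial_prod => //; first by rewrite subn_gt0.
move=> i ik; apply: measurable_fun_cylinders.
by rewrite !inE mem_iota; lia.
Qed.

Let disjoint_prefix_suffix k : [disjoint prefix k & suffix k]%fset.
Proof. by apply/fdisjointP => i; rewrite !inE !mem_iota; lia. Qed.

(** The hypothesis relating [A] and [A'] says that [A'] contains the closed
    [b]-neighbourhood of [A]; the two inequalities of the theorem differ only in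
    the choice of these sets. *)
Lemma ottaviani (b : R) (A A' : set (borel G)) m : 0 <= b ->
  (1 <= m <= n)%N -> measurable A -> measurable A' ->
  (forall x y : G, mdist x y <= b -> A x -> A' y) ->
  (mu [set t | exists2 k, (m <= k <= n)%N & A (S k t)]
     * \big[mine/+oo]_(m <= k < n.+1)
         mu [set t | (mdist (S k t) (S n t) <= b)%R]
   <= mu [set t | A' (S n t)])%E.
Proof.
move=> b0 /andP[m0 mn] mA mA' AA'.
pose C i := S (m + i) @^-1` A.
have mS (Q : set (borel G)) k :
    measurable Q -> (0 < k)%N -> measurable (S k @^-1` Q).
  by move=> mQ k0; rewrite -[X in measurable X]setTI; exact: measurable_S.
rewrite (_ : mkset _ = \big[setU/set0]_(i < (n - m).+1) C i); last first.
  rewrite -bigcup_mkord; apply/seteqP; split => [t [k kmn At]|t [i /= im At]].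
    by exists (k - m)%N => /=; [lia|rewrite /C/= subnKC//; lia].
  by exists (m + i)%N => //; lia.
apply: first_entrance_le => [i||i im].
- by apply: mS => //; lia.
- by apply: mS => //; lia.
set B := fun k => [set t | mdist (S k t) (S n t) <= b].
have : (\big[mine/+oo]_(m <= k < n.+1) mu (B k) <= mu (B (m + i)%N))%E.
  by apply: ge_bigmin_seq => //; rewrite mem_index_iota; lia.
move: (\big[_/_]_(_ <= _ < _) _) => beta betaB.
have mCi j : measurable (C j) by apply: mS => //; lia.
have mD := seqDU_measurable mCi.
have [mi|mi] := ltnP (m + i)%N n; last first.
  (* At the last time [k = n] there are no later variables to be independent
     of, but then [B n] is the whole space. *)
  have {}mi : (m + i)%N = n by lia.
  rewrite (_ : seqDU C i `&` _ = seqDU C i); last first.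
    rewrite setIidl// => t [+ _]; rewrite /C/= mi => /AA'; apply.
    by rewrite mdistxx.
  rewrite -[leRHS]mule1 lee_wpmul2l//; apply: (le_trans betaB).
  rewrite mi (_ : B n = setT) ?probability_setT//.
  by apply/seteqP; split => // t _; rewrite /B/= mdistxx.
have sB := @measurable_suffix (m + i) b.
have {}sB : <<s cylinders X (suffix (m + i)) >> (B (m + i)%N) by apply: sB; lia.
have sC : <<s cylinders X (prefix (m + i)) >> (seqDU C i).
  pose blockT := g_sigma_algebraType (cylinders X (prefix (m + i))).
  rewrite /seqDU; apply: (@measurableD _ blockT).
    by apply: measurable_prefix => //; lia.
  apply: (@bigsetU_measurable _ blockT).
  by move=> j _; apply: measurable_prefix => //; have := ltn_ord j; lia.
apply: (@le_trans _ _ (mu (seqDU C i) * mu (B (m + i)%N))%E).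
  by rewrite lee_wpmul2l.
rewrite -(independent_blocks indepX (disjoint_prefix_suffix (m + i)) _ _ sC sB);
  last 2 first.
- by move=> j /=; rewrite !inE mem_iota; lia.
- by move=> j /=; rewrite !inE mem_iota; lia.
apply: le_measure; rewrite ?inE.
- by apply: measurableI => //; exact: g_cylinders_measurable sB.
- by apply: measurableI => //; apply: mS => //; lia.
- by move=> t [Dt Bt]; split => //; case: Dt => At _; exact: AA' Bt At.
Qed.

End ottaviani.

Theorem proposition2p7 (R : realType) (G : metricSemigroupType R)
    (sepG : separable G)
    (disp : measure_display) (Omega : measurableType disp)
    (mu : probability Omega R)
    (z0 z1 : G) (a b : R) (a_ge0 : 0 <= a) (b_ge0 : 0 <= b)
    (n : nat) (X : nat -> {RV mu >-> borel G})
    (indepX : mutually_independent mu [set i : nat | (1 <= i <= n)%N] X) :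
  let S (k : nat) (w : Omega) : G := partial_prod (fun i => X i w : G) k in
  forall m : nat, (1 <= m <= n)%N ->
  (mu [set w | \big[mine/+oo]_(m <= k < n.+1)
                 (mdist z1 (z0 * S k w)%g)%:E <= a%:E]
     * \big[mine/+oo]_(m <= k < n.+1)
         mu [set w | (mdist (S k w) (S n w) <= b)%R]
   <= mu [set w | (mdist z1 (z0 * S n w)%g <= a + b)%R])%E
  /\
  (mu [set w | \big[maxe/-oo]_(m <= k < n.+1)
                 (mdist z1 (z0 * S k w)%g)%:E >= a%:E]
     * \big[mine/+oo]_(m <= k < n.+1)
         mu [set w | (mdist (S k w) (S n w) <= b)%R]
   <= mu [set w | (mdist z1 (z0 * S n w)%g >= a - b)%R])%E.
Proof.
move=> S m mn.
pose h g : R := mdist z1 (z0 * g)%g.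
have h1 x y : h y <= h x + mdist x y.
  by rewrite -(mdist_mull x y z0); exact: metric_triangle.
have mle r : measurable ([set g | h g <= r] : set (borel G)).
  apply: measurable_borel_closed; apply: (@closed_lipschitz_le _ _ _ 1) => //.
  by move=> x y; rewrite mul1r.
have mge r : measurable ([set g | r <= h g] : set (borel G)).
  rewrite (_ : mkset _ = [set g | - h g <= - r]).
    apply: measurable_borel_closed; apply: (@closed_lipschitz_le _ _ _ 1) => //.
    by move=> x y; have := h1 y x; rewrite metric_sym; lra.
  by apply/seteqP; split => g /=; rewrite lerN2.
split.
- rewrite (_ : mkset _ = [set w | exists2 k, (m <= k <= n)%N & h (S k w) <= a]).
    apply: (ottaviani sepG indepX (A := [set g | h g <= a])
      (A' := [set g | h g <= a + b])) => // x y xy hx.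
    by have := h1 x y; rewrite /= in hx *; lra.
  apply/seteqP; split => w /=; rewrite big_geq_mkord.
    move/bigmin_leP => [//|[k /= mk]]; rewrite lee_fin => hk.
    by exists k => //; rewrite mk -ltnS ltn_ord.
  move=> [k /andP[mk kn] hk]; apply/bigmin_leP; right.
  by exists (Ordinal (kn : k < n.+1)%N).
- rewrite (_ : mkset _ = [set w | exists2 k, (m <= k <= n)%N & a <= h (S k w)]).
    apply: (ottaviani sepG indepX (A := [set g | a <= h g])
      (A' := [set g | a - b <= h g])) => // x y xy hx.
    by have := h1 y x; rewrite metric_sym /= in hx *; lra.
  apply/seteqP; split => w /=; rewrite big_geq_mkord.
    move/bigmax_geP => [//|[k /= mk]]; rewrite lee_fin => hk.
    by exists k => //; rewrite mk -ltnS ltn_ord.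
  move=> [k /andP[mk kn] hk]; apply/bigmax_geP; right.
  by exists (Ordinal (kn : k < n.+1)%N).
Qed.
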